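(* A normal extremal (as defined in the context) $(\{g_k\}_{k=0}^{N},\{u_k\}_{k=0}^{N-1},\{\mu_k\}_{k=0}^{N-1})$ of the discrete-time optimal control problem $$\min_{\{u_k\}_{k=0}^{N-1}}\sum_{k=0}^{N-1}\big[C_d(g_k,u_k)+V_d(g_k)\big]\quad\text{subject to}\quad g_{k+1}=g_k\tau(hu_k),\quad\text{with given boundary conditions } g_0 \text{ and } g_N,$$ under the assumptions (i)--(vi) listed in the context, satisfies, with $\bar\alpha_k=\rho^*_{g_k}(\alpha_0)\in X^*$, the following discrete-time Lie--Poisson equations: $$(d\tau^{-1}_{hu_k})^*\mu_k=(d\tau^{-1}_{-hu_{k-1}})^*\mu_{k-1}+\mathbf J_X\left(\frac{\partial V_{d,\mathrm{ext}}}{\partial\bar\alpha_k},\bar\alpha_k\right)\qquad(k=1,\dots,N-1),$$ $$\bar\alpha_{k+1}=\rho^*_{\tau(hu_k)}(\bar\alpha_k)\quad(k=0,\dots,N-1),\qquad\bar\alpha_0=\rho^*_{g_0}(\alpha_0),$$ where $\mu_k=\frac1h\frac{\partial C_d}{\partial u_k}\in\mathfrak g^*$.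
   Context: Lie group and controls. $G$ is an $n$-dimensional Lie group with identity $e$ and Lie algebra $\mathfrak g$ with basis $e_1,\dots,e_n$; $1\le m\le n$, $\mathfrak k=\mathrm{span}\{e_1,\dots,e_m\}$, $\mathfrak p=\mathrm{span}\{e_{m+1},\dots,e_n\}$, $e_0\in\mathfrak p$ is fixed, and $E=G\times\mathfrak k$. The controls are $u_k=e_0+\sum_{i=1}^m u_k^ie_i$ with $u_k^i\in\mathbb R$. With $\mathfrak g=\mathfrak k\oplus\mathfrak p$ one has $\mathfrak g^*=\mathfrak k^*\oplus\mathfrak p^*$, where $\mathfrak k^*$ is identified with the annihilator of $\mathfrak p$ and $\mathfrak p^*$ with the annihilator of $\mathfrak k$. In the cost, $C_d(g_k,u_k)$ is understood as the function $C_d$ on $E$ evaluated at $(g_k,u_k-e_0)$. Retraction map. $h>0$ is the time step. $\tau:\mathfrak g\to G$ is a retraction map: a smooth map which is a diffeomorphism from a neighborhood of $0$ onto a neighborhood of $e$, with $\tau(0)=e$ and $\tau(\xi)\tau(-\xi)=e$; all $\pm hu_k$ lie in this neighborhood of $0$, and $\tau^{-1}$ is the corresponding local inverse. The right trivialized tangent $d\tau_\xi:\mathfrak g\to\mathfrak g$ is defined by $T_\xi\tau(\delta)=T_eR_{\tau(\xi)}(d\tau_\xi\delta)$, where $R$ is right translation; $d\tau_\xi^{-1}$ is its inverse and $(d\tau^{-1}_\xi)^*:\mathfrak g^*\to\mathfrak g^*$ is the dual of the latter. Assumptions. (i) $C_d:E\to\mathbb R$ is sufficiently regular and $G$-invariant: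 $C_d(gg',v)=C_d(g',v)$ for all $g,g'\in G$, $v\in\mathfrak k$. (ii) $V_d:G\to\mathbb R$ is sufficiently regular and is not $G$-invariant. (iii) $V_d$ depends on a parameter $\alpha_0\in X^*$, the dual of a vector space $X$: there is an extended potential $V_{d,\mathrm{ext}}:G\times X^*\to\mathbb R$ with $V_{d,\mathrm{ext}}(\cdot,\alpha_0)=V_d$. (iv) $\rho:G\to\mathrm{GL}(X)$ is a left representation; $\rho_g^*\in\mathrm{GL}(X^* )$ is the adjoint of $\rho_g$, $\langle\rho_g^*(\alpha),x\rangle=\langle\alpha,\rho_g(x)\rangle$, so that $(g,(g',\alpha))\mapsto(gg',\rho^*_{g^{-1}}(\alpha))$ is a left action of $G$ on $G\times X^*$. (v) $V_{d,\mathrm{ext}}$ is invariant under this action: $V_{d,\mathrm{ext}}(gg',\rho^*_{g^{-1}}(\alpha))=V_{d,\mathrm{ext}}(g',\alpha)$ for all $g,g'\in G$, $\alpha\in X^*$. (vi) $V_d$ is invariant under the left action of the isotropy group $G_{\alpha_0}=\{g\in G:\rho_g^*(\alpha_0)=\alpha_0\}$. Notation. $C_d(v):=C_d(e,v)$ for $v\in\mathfrak k$, and $\frac{\partial C_d}{\partial u_k}$ is the differential of $C_d$ at $u_k-e_0$, an element of $\mathfrak k^*\subset\mathfrak g^*$. $V_{d,\mathrm{ext}}(\alpha):=V_{d,\mathrm{ext}}(e,\alpha)$, and $\frac{\partial V_{d,\mathrm{ext}}}{\partial\bar\alpha_k}\in X^{**}\cong X$ is its differential at $\bar\alpha_k$.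 $\rho':\mathfrak g\to\mathfrak{gl}(X)$ is the Lie algebra representation induced by $\rho$, and $\mathbf J_X:X\times X^*\to\mathfrak g^*$ is the momentum map $\langle\mathbf J_X(x,\alpha),\xi\rangle=\langle\alpha,\rho'_\xi(x)\rangle$. Normal extremal. Define the augmented Lagrangian, for $\mu_k\in\mathfrak g^*$ and $u_k\in e_0+\mathfrak k$, by $$L_{d,a,\alpha_0}(g_k,g_{k+1},u_k,\mu_k)=C_d(g_k,u_k-e_0)+V_{d,\mathrm{ext}}(g_k,\alpha_0)+h\left\langle\mu_k,\tfrac1h\tau^{-1}(g_k^{-1}g_{k+1})-(u_k-e_0)\right\rangle.$$ A normal extremal is a collection $(\{g_k\},\{u_k\},\{\mu_k\})$ with $g_0,g_N$ as prescribed, $u_k\in e_0+\mathfrak k$, $g_{k+1}=g_k\tau(hu_k)$ and multipliers $\mu_k\in\mathfrak g^*$, satisfying the variational principle $\delta\sum_{k=0}^{N-1}L_{d,a,\alpha_0}(g_k,g_{k+1},u_k,\mu_k)=0$ for all variations of $g_k$ vanishing at $k=0$ and $k=N$, the variations of $\tau^{-1}(g_k^{-1}g_{k+1})$ induced by them, and all variations of $u_k$ (since $u_k\in e_0+\mathfrak k$, these are $\delta u_k\in\mathfrak k$).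
   Formalization: Since δu_k lies only in k, the equality μ_k = (1/h)∂C_d/∂u_k in g* can fail when m < n; it is stated for the k*-component of μ_k, and in g* whenever μ_k lies in k*. The Lie–Poisson equation is stated for the full μ_k. *)

(* Defs.v *)
From HB Require Import structures.
From mathcomp Require Import all_boot all_order all_algebra.
From mathcomp Require Import all_classical all_reals.
From mathcomp Require Import topology normedtype derive.

Set Implicit Arguments.
Unset Strict Implicit.
Unset Printing Implicit Defensive.

Import Order.TTheory GRing.Theory Num.Theory.
Import numFieldNormedType.Exports.
Import VectorInternalTheory.

Local Open Scope classical_set_scope.
Local Open Scope ring_scope.

(* A finite-dimensional vector space with its canonical topology.  A [vectType]
   carries no topology; the sup norm of the coordinates of [v2r] is used, all
   norms being equivalent in finite dimension. *)
Definition fdspace (R : realType) (V : vectType R) : Type := V.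

Section FdSpace.
Variables (R : realType) (V : vectType R).

HB.instance Definition _ := Vector.on (fdspace V).

Let nrm (x : fdspace V) : R := `|v2r x|.

Let nrmD (x y : fdspace V) : nrm (x + y) <= nrm x + nrm y.
Proof. by rewrite /nrm linearD ler_normD. Qed.

Let nrmZ (l : R) (x : fdspace V) : nrm (l *: x) = `|l| * nrm x.
Proof. by rewrite /nrm linearZ normrZ. Qed.

Let nrm0 (x : fdspace V) : nrm x = 0 -> x = 0.
Proof.
move=> /eqP; rewrite normr_eq0 => /eqP x0.
by apply: (can_inj v2rK); rewrite x0 linear0.
Qed.

HB.instance Definition _ := Lmodule_isNormed.Build R (fdspace V) nrmD nrmZ nrm0.

End FdSpace.

Notation dual V := ('Hom(V, _^o)) (only parsing).

(* On a finite-dimensional [E] this is the usual notion of a [C^k] map on an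
   open set: all iterated directional derivatives up to order [k] exist and
   are continuous. *)
Fixpoint Ck (R : realType) (E F : normedModType R) (k : nat) (U : set E)
    (f : E -> F) : Prop :=
  if k is k'.+1 then
    (forall x, U x -> differentiable f x)
    /\ (forall v, Ck k' U (fun x => 'D_v f x))
  else forall x, U x -> {for x, continuous f}.

(* A homeomorphism between an open set of [M] and an open set of [E]; the
   values of the two maps outside these sets are irrelevant. *)
Record chart (R : realType) (M : topologicalType) (E : normedModType R) :=
  Chart {
    cdom : set M;
    ctgt : set E;
    cto :> M -> E;
    cfrom : E -> M;
    cdom_open : open cdom;
    ctgt_open : open ctgt;
    cto_tgt : forall x, cdom x -> ctgt (cto x);
    cfrom_dom : forall v, ctgt v -> cdom (cfrom v);
    ctoK : forall x, cdom x -> cfrom (cto x) = x;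
    cfromK : forall v, ctgt v -> cto (cfrom v) = v;
    cto_cts : forall x, cdom x -> {for x, continuous cto};
    cfrom_cts : forall v, ctgt v -> {for v, continuous cfrom} }.

(* An atlas is recorded as a choice of a chart around every point; the tangent
   space at [x] is then [E], in the coordinates of [chart_at x]. *)
Record charted (R : realType) (E : normedModType R) := Charted {
  charted_sort :> topologicalType;
  chart_at : charted_sort -> chart charted_sort E;
  chart_at_dom : forall x, cdom (chart_at x) x }.

Section ChartedExamples.
Variable R : realType.

Section Vec.
Variable E : normedModType R.

Definition vec_chart : chart E E.
Proof.
by apply: (@Chart R E E setT setT id id) => //; try exact: openT;
  move=> x _; exact: cvg_id.
Defined.

Definition vec : charted E :=
  @Charted R E E (fun _ => vec_chart) (fun _ => I).

End Vec.

Section Prod.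
Variables (E F : normedModType R).

Let prod_open (S T : topologicalType) (A : set S) (B : set T) :
  open A -> open B -> open (A `*` B).
Proof.
move=> oA oB; rewrite openE => -[x y] [/= Ax By].
exists (A, B) => //=; split; exact: open_nbhs_nbhs.
Qed.

Let prod_cts (S T S' T' : topologicalType) (f : S -> S') (g : T -> T')
    (p : S * T) :
  {for p.1, continuous f} -> {for p.2, continuous g} ->
  {for p, continuous (fun q : S * T => (f q.1, g q.2))}.
Proof.
move=> cf cg; apply: cvg_pair => /=.
  by apply: (@continuous_comp _ _ _ fst f p) => //; exact: cvg_fst.
by apply: (@continuous_comp _ _ _ snd g p) => //; exact: cvg_snd.
Qed.

Definition prod_chart (S T : topologicalType) (c : chart S E) (d : chart T F) :
  chart (S * T)%type (E * F)%type.
Proof.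
apply: (@Chart R (S * T)%type (E * F)%type (cdom c `*` cdom d)
  (ctgt c `*` ctgt d) (fun p => (c p.1, d p.2))
  (fun v => (cfrom c v.1, cfrom d v.2))).
- exact: prod_open (cdom_open c) (cdom_open d).
- exact: prod_open (ctgt_open c) (ctgt_open d).
- by move=> x [? ?]; split; exact: cto_tgt.
- by move=> x [? ?]; split; exact: cfrom_dom.
- by move=> [x y] [? ?] /=; rewrite !ctoK.
- by move=> [x y] [? ?] /=; rewrite !cfromK.
- by move=> x [? ?]; apply: prod_cts; exact: cto_cts.
- by move=> x [? ?]; apply: prod_cts; exact: cfrom_cts.
Defined.

Definition cprod (M : charted E) (N : charted F) : charted (E * F)%type :=
  @Charted R (E * F)%type (M * N)%type
    (fun p => prod_chart (chart_at p.1) (chart_at p.2))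
    (fun p => conj (chart_at_dom p.1) (chart_at_dom p.2)).

End Prod.
End ChartedExamples.

Section Calculus.
Variables (R : realType) (E F : normedModType R).
Variables (M : charted E) (N : charted F).

(* [f] read in the charts around [x] and [y] *)
Definition in_charts (f : M -> N) (x : M) (y : N) : E -> F :=
  fun v => chart_at y (f (cfrom (chart_at x) v)).

(* [f] is of class [C^k] on the open set [W] *)
Definition Ck_on (k : nat) (W : set M) (f : M -> N) : Prop :=
  (forall x, W x -> {for x, continuous f}) /\
  forall x y,
    Ck k (chart_at x @` (cdom (chart_at x) `&` W `&` f @^-1` cdom (chart_at y)))
       (in_charts f x y).

Definition smooth_on (W : set M) (f : M -> N) : Prop := forall k, Ck_on k W f.

(* the tangent map [T_x f : T_x M -> T_(f x) N] *)
Definition tmap (f : M -> N) (x : M) : {linear E -> F} :=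
  'd (in_charts f x (f x)) (chart_at x x).

End Calculus.
Arguments Ck_on {R E F} M N k W f.
Arguments smooth_on {R E F} M N W f.
Arguments tmap {R E F} M N f x.

Notation C1 M N f := (Ck_on M N 1 setT f).
Notation smooth M N f := (smooth_on M N setT f).

(* Transition maps are the coordinate expressions of the identity. *)
Definition is_manifold (R : realType) (E : normedModType R) (M : charted E) :=
  [/\ hausdorff_space M, @second_countable M & smooth M M id].

#[short(type="topGroupType")]
HB.structure Definition TopGroup := {G of Topological G & Group G}.

Definition lie_axiom (R : realType) (n : nat) (G : topGroupType)
    (c : forall x : G, chart G 'rV[R]_n) (cP : forall x, cdom (c x) x) :=
  let M := Charted cP in
  [/\ is_manifold M,
      smooth (cprod M M) M (fun p => p.1 * p.2)%g &
      smooth M M (fun x => x^-1)%g].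

(* An [n]-dimensional real Lie group.  Its Lie algebra, i.e. the tangent space
   at [1%g], is ['rV[R]_n]. *)
Record lieGroup (R : realType) (n : nat) := LieGroup {
  lie_sort :> topGroupType;
  lie_chart : forall x : lie_sort, chart lie_sort 'rV[R]_n;
  lie_chart_dom : forall x, cdom (lie_chart x) x;
  lieP : lie_axiom lie_chart_dom }.

Definition man (R : realType) (n : nat) (G : lieGroup R n) : charted 'rV[R]_n :=
  Charted (@lie_chart_dom R n G).

Section Retraction.
Variables (R : realType) (n : nat) (G : lieGroup R n).
Local Notation g := 'rV[R]_n.

(* [U] is the neighbourhood of [0] and [tauinv] the local inverse, defined on
   [tau @` U]. *)
Definition is_retraction (tau : g -> G) (U : set g) (tauinv : G -> g) : Prop :=
  [/\ smooth (vec g) (man G) tau,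
      [/\ open U, U 0 & open (tau @` U)],
      (forall xi, U xi -> tauinv (tau xi) = xi)
        /\ smooth_on (man G) (vec g) (tau @` U) tauinv,
      tau 0 = 1%g &
      forall xi, (tau xi * tau (- xi))%g = 1%g].

(* The solution of [T_xi tau = T_e R_(tau xi) \o dtau xi]. *)
Definition dtau (tau : g -> G) (xi : g) : 'End(g) :=
  ((linfun (tmap (man G) (man G) (fun x => x * tau xi)%g 1%g))^-1
     \o linfun (tmap (vec g) (man G) tau xi))%VF.

(* [(dtau_xi^-1)^* mu] *)
Definition dtauinv_adj (tau : g -> G) (xi : g) (mu : dual g) : dual g :=
  (mu \o (dtau tau xi)^-1)%VF.

End Retraction.

Section Representation.
Variables (R : realType) (n : nat) (G : lieGroup R n) (X : vectType R).
Local Notation g := 'rV[R]_n.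

Definition is_representation (rho : G -> 'End(X)) : Prop :=
  [/\ rho 1%g = \1%VF,
      forall a b : G, rho (a * b)%g = (rho a \o rho b)%VF &
      smooth (man G) (vec (fdspace 'End(X))) rho].

Definition rho_adj (rho : G -> 'End(X)) (a : G) (alpha : dual X) : dual X :=
  (alpha \o rho a)%VF.

Definition rho' (rho : G -> 'End(X)) (xi : g) : 'End(X) :=
  tmap (man G) (vec (fdspace 'End(X))) rho 1%g xi.

Definition momentum_map (rho : G -> 'End(X)) (x : X) (alpha : dual X) : dual g :=
  linfun (fun xi : g => alpha (rho' rho xi x) : R^o).

(* The canonical isomorphism [X -> X^**]. *)
Definition bidual_eval : 'Hom(X, dual (dual X)) :=
  linfun (fun x : X => linfun (fun alpha : dual X => alpha x : R^o)).

(* [dVext_ (e, .)] at [alpha], as an element of [X ~ X^**] *)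
Definition dVext (Vext : G * fdspace (dual X) -> R) (alpha : dual X) : X :=
  (bidual_eval^-1)%VF
    (linfun ('d (fun a : fdspace (dual X) => Vext (1%g, a) : R^o)
                (alpha : fdspace (dual X)))).

End Representation.

Section Control.
Variables (R : realType) (n m : nat) (G : lieGroup R n).
Local Notation g := 'rV[R]_n.
Variable e : n.-tuple g.

Definition kspace : {vspace g} := <<take m e>>%VS.
Definition pspace : {vspace g} := <<drop m e>>%VS.

(* The [k^*]-component of a covector, [k^*] being the annihilator of [pspace].
   As controls vary in [e0 + kspace] only, stationarity in the controls
   determines just this component of the multipliers. *)
Definition kstar_part (mu : dual g) : dual g :=
  (mu \o daddv_pi kspace pspace)%VF.

Variable e0 : g.

Definition kpart (u : g) : fdspace (subvs_of kspace) := vsproj kspace (u - e0).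

(* The differential of [Cd (e, .)] at [u - e0], extended by [0] on [pspace]. *)
Definition dCd (Cd : G * fdspace (subvs_of kspace) -> R) (u : g) : dual g :=
  ((linfun ('d (fun v : fdspace (subvs_of kspace) => Cd (1%g, v) : R^o) (kpart u))
      : dual (subvs_of kspace))
     \o (linfun (vsproj kspace) \o daddv_pi kspace pspace))%VF.

Variables (X : vectType R) (h : R) (tau : g -> G) (tauinv : G -> g).
Variables (Cd : G * fdspace (subvs_of kspace) -> R).
Variables (Vext : G * fdspace (dual X) -> R) (alpha0 : dual X).

Definition aug_lagrangian (g0 g1 : G) (u : g) (mu : dual g) : R :=
  Cd (g0, kpart u) + Vext (g0, alpha0)
  + h * mu (h^-1 *: tauinv (g0^-1 * g1)%g - (u - e0)).

(* Smooth one-parameter variations, with fixed end points, of [gs 0, .., gs N]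
   and [us 0, .., us N.-1]. *)
Definition is_variation (N : nat) (gs : nat -> G) (us : nat -> g)
    (gv : nat -> R -> G) (uv : nat -> R -> g) : Prop :=
  [/\ forall k, (k <= N)%N ->
        smooth (vec R^o) (man G) (gv k) /\ gv k 0 = gs k,
      forall s, gv 0%N s = gs 0%N /\ gv N s = gs N &
      forall k, (k < N)%N ->
        [/\ smooth (vec R^o) (vec g) (uv k), uv k 0 = us k &
            forall s, uv k s - e0 \in kspace]].

(* Only [gs k] for [k <= N], and [us k], [mus k] for [k < N], are relevant. *)
Definition normal_extremal (N : nat) (gi gf : G)
    (gs : nat -> G) (us : nat -> g) (mus : nat -> dual g) : Prop :=
  [/\ gs 0%N = gi /\ gs N = gf,
      forall k, (k < N)%N -> us k - e0 \in kspace,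
      forall k, (k < N)%N -> gs k.+1 = (gs k * tau (h *: us k))%g &
      forall gv uv, is_variation N gs us gv uv ->
        is_derive (0 : R) 1
          (fun s : R => \sum_(k < N)
             aug_lagrangian (gv k s) (gv k.+1 s) (uv k s) (mus k)) 0].

End Control.

(* Main.v *)
From HB Require Import structures.
Require Import Defs.
From mathcomp Require Import all_boot all_order all_algebra.
From mathcomp Require Import all_classical all_reals.
From mathcomp Require Import topology normedtype derive landau.

Set Implicit Arguments.
Unset Strict Implicit.
Unset Printing Implicit Defensive.

Import Order.TTheory GRing.Theory Num.Theory.
Import numFieldNormedType.Exports.
Import VectorInternalTheory.

Local Open Scope classical_set_scope.
Local Open Scope ring_scope.

(** Why the equations hold. The action is differentiated along two families of
    variations.

    To test the group variable of index [k], [gs k] is moved along the curve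
    [s |-> gs k * tau (s *: w)], all the other variables being fixed. Since the
    differential of [tau] at 0 is onto, its velocities at [s = 0] are all the
    vectors [eta] of the Lie algebra, and since [tau (- xi)] is the inverse of
    [tau xi], both discrete velocities that involve [gs k] take a simple form:
    - in the summand [k] it is [tauinv (tau (- s w) * tau (h u_k))], with
      derivative [- (dtau_(h u_k))^-1 eta];
    - in the summand [k - 1] it is [tauinv (tau (h u_(k-1)) * tau (s w))], which
      is the opposite of [tauinv (tau (- s w) * tau (- h u_(k-1)))], with
      derivative [(dtau_(- h u_(k-1)))^-1 eta].
    Both derivatives come from one computation ([is_diff_tau_mul]): the
    differential at 0 of right multiplication by [tau xi], read through [tau],
    is the inverse of the right trivialized tangent ([near_tau_mulN] reduces the
    second case to it). The running cost [Cd] does not change, by invariance. By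
    invariance of the extended potential, [Vext (gs k * tau (s w), alpha0)] is
    [Vext (1, rho_(tau (s w))^* alpha_k)] with [alpha_k = rho_(gs k)^* alpha0],
    and its derivative is the momentum map at [eta] ([is_diff_potential]). That
    these three derivatives sum to zero for all [eta] is the discrete
    Lie-Poisson equation ([momentum_recursion]).

    To test the control, [us k] is moved along a line in [kspace]; this
    identifies the restriction of [h *: mus k] to [kspace] with the differential
    of the cost ([stationary_control]). The advection equation only says that
    [a |-> rho_a^*] reverses products.

    The variations have to be smooth curves in the group, so the composite
    [s |-> gs k * tau (s *: w)] must be shown to be of class C^k for all k. This
    rests on the stability of C^k maps under composition ([Ck_comp]), which
    carries over to manifolds ([smooth_comp]). *)

(** * C^k maps between normed spaces *)

Section Ck.
Variable R : realType.
Implicit Types E F : normedModType R.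

(** Differentiability only depends on the germ of the map: the difference of the
    two maps vanishes near the point, so it is negligible at first order. *)
Lemma near_eq_is_diff E F (f g : E -> F) x :
  (\near x, f x = g x) -> differentiable f x ->
  differentiable g x /\ 'd g x = 'd f x :> (E -> F).
Proof.
move=> fg df; pose k := g - f.
have k0 : \near x, k x = 0.
  by near=> y; rewrite /k fctE; apply/eqP; rewrite subr_eq0 eq_sym; apply/eqP;
     near: y.
have dk : is_diff x k 0.
  have ko : k \o shift x = cst (k x) + (0 : E -> F) +o_ 0 id.
    apply: eqaddoE; rewrite funeqE => y /=.
    rewrite (nbhs_singleton k0) addr0 add0r.
    rewrite -[LHS]/((k \o shift x) y); congr (_ y).
    apply/eqoP => e e0.
    have := k0; rewrite (near_shift 0 x) /= => H.
    near=> z.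
    rewrite (_ : k _ = 0) ?normr0 ?mulr_ge0 ?(ltW e0)//.
    by rewrite /=; near: z; apply: filterS H => z /=; rewrite subr0.
  have d0 : 'd k x = 0 :> (E -> F).
    apply: (@diff_unique _ _ _ k (\0 : {linear E -> F}) x) => //.
    exact: cst_continuous.
  apply: DiffDef => //; apply/diff_locallyP; rewrite d0; split => //.
  exact: cst_continuous.
have -> : g = f + k by rewrite /k addrC subrK.
have [d dE] := is_diffD (differentiableP df) dk.
split=> //; exact: etrans dE (addr0 ('d f x : E -> F)).
Unshelve. all: by end_near. Qed.

Lemma Ck_subset E F k (U V : set E) (f : E -> F) :
  V `<=` U -> Ck k U f -> Ck k V f.
Proof.
move=> VU; elim: k f => [|k IH] f /=; first by move=> c x /VU; exact: c.
by case=> d D; split => [x /VU /d //|v]; exact/IH/D.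
Qed.

(** The hypothesis is about germs, so that it passes to the directional
    derivatives; the closure properties can then replace a directional
    derivative by the formula that computes it on an open set. *)
Lemma Ck_eq_near E F k (U : set E) (f g : E -> F) :
  (forall x, U x -> \near x, f x = g x) -> Ck k U f -> Ck k U g.
Proof.
elim: k f g => [|k IH] f g fg /=.
  move=> c x Ux; have := c x Ux; rewrite /prop_for /continuous_at.
  rewrite (nbhs_singleton (fg x Ux)); apply: cvg_trans.
  exact: near_eq_cvg (fg x Ux).
case=> d D; split=> [x Ux|v].
  by case: (near_eq_is_diff (fg x Ux) (d x Ux)).
apply: IH _ (D v) => x Ux; have /near_join H := fg x Ux.
by near=> y; apply: near_eq_derive; near: y.
Unshelve. all: by end_near. Qed.

Lemma CkW E F k (U : set E) (f : E -> F) : Ck k.+1 U f -> Ck k U f.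
Proof.
elim: k f => [|k IH] f [d D] /=.
  by move=> x /d; exact: differentiable_continuous.
by split=> // v; exact/IH/D.
Qed.

Lemma Ck_cst E F k (U : set E) (a : F) : Ck k U (cst a : E -> F).
Proof.
elim: k a => [|k IH] a; first by move=> x _; exact: cst_continuous.
split=> [x _|v]; first exact: differentiable_cst.
rewrite (_ : (fun x => _) = cst 0); first exact: IH.
by apply/funext => x; rewrite derive_cst.
Qed.

Lemma Ck_linear E F k (U : set E) (L : {linear E -> F}) :
  continuous L -> Ck k U L.
Proof.
move=> cL; case: k => [|k]; first by move=> x _; exact: cL.
split=> [x _|v]; first exact: linear_differentiable.
rewrite (_ : (fun x => _) = cst (L v)); first exact: Ck_cst.
by apply/funext => x; rewrite deriveE ?diff_lin//; exact: linear_differentiable.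
Qed.

Lemma near_open E (U : set E) (P : E -> Prop) x :
  open U -> (forall y, U y -> P y) -> U x -> \near x, P x.
Proof. by move=> oU UP Ux; apply: filterS UP _; exact: open_nbhs_nbhs. Qed.

Lemma CkD E F k (U : set E) (f g : E -> F) : open U ->
  Ck k U f -> Ck k U g -> Ck k U (f + g).
Proof.
move=> oU; elim: k f g => [|k IH] f g.
  by move=> cf cg x Ux; apply: continuousD; [exact: cf|exact: cg].
move=> [df Df] [dg Dg]; split=> [x Ux|v].
  by apply: differentiableD; [exact: df|exact: dg].
apply: Ck_eq_near (IH _ _ (Df v) (Dg v)) => x; apply: near_open => // y Uy.
by rewrite deriveD//; apply: diff_derivable; [exact: df|exact: dg].
Qed.

Lemma Ck_sum E F k (U : set E) n (f : 'I_n -> E -> F) : open U ->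
  (forall i, Ck k U (f i)) -> Ck k U (\sum_(i < n) f i).
Proof.
move=> oU Cf.
by elim/big_ind : _ => [|g1 g2|i _]; [exact: Ck_cst|exact: CkD|exact: Cf].
Qed.

Lemma is_diff_scale E F (a : E -> R^o) (f : E -> F) x :
  differentiable a x -> differentiable f x ->
  differentiable (fun y => a y *: f y) x /\
  forall v, 'd (fun y => a y *: f y) x v = a x *: 'd f x v + 'd a x v *: f x.
Proof.
move=> da df.
have bil : bilinear_for
    (GRing.Scale.Law.clone _ _ *:%R _) (GRing.Scale.Law.clone _ _ *:%R _)
    (fun (a : R^o) (w : F) => a *: w).
  by split=> [w|b] c u v /=; rewrite ?scalerDl ?scalerDr ?scalerA// mulrC.
pose BM := bilinear_isBilinear.Build R R^o F F _ _ _ bil.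
pose B : {bilinear R^o -> F -> F} :=
  HB.pack (fun (a : R^o) (w : F) => a *: w) BM.
have cB : continuous (fun p : R^o * F => B p.1 p.2).
  by move=> p; exact: scale_continuous.
have dB : differentiable (fun p : R^o * F => B p.1 p.2) (a x, f x).
  exact: differentiable_bilin.
have dp : differentiable (fun y => (a y, f y)) x by exact: differentiable_pair.
split; first exact: (differentiable_comp dp dB).
move=> v; have /(congr1 (@^~ v)) := diff_comp dp dB.
by rewrite diff_bilin//= => ->; rewrite diff_pair.
Qed.

Lemma Ck_scale E F k (U : set E) (a : E -> R^o) (f : E -> F) : open U ->
  Ck k U a -> Ck k U f -> Ck k U (fun y => a y *: f y).
Proof.
move=> oU; elim: k a f => [|k IH] a f.
  by move=> ca cf x Ux; apply: continuousZ; [exact: ca|exact: cf].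
move=> Ca Cf; have [da Da] := Ca; have [df Df] := Cf; split=> [x Ux|v].
  by case: (is_diff_scale (da x Ux) (df x Ux)).
apply: (@Ck_eq_near _ _ _ _
  ((fun y => a y *: 'D_v f y) + (fun y => 'D_v a y *: f y))).
  move=> x; apply: near_open => // y Uy.
  have [d dE] := is_diff_scale (da y Uy) (df y Uy).
  have day := da y Uy; have dfy := df y Uy.
  by rewrite [RHS]deriveE// dE fctE !deriveE.
apply: CkD => //; first exact: IH (CkW Ca) (Df v).
exact: IH (Da v) (CkW Cf).
Qed.

Lemma Ck_postlin E F F' k (U : set E) (L : {linear F -> F'}) (f : E -> F) :
  open U -> continuous L -> Ck k U f -> Ck k U (L \o f).
Proof.
move=> oU cL; elim: k f => [|k IH] f.
  by move=> cf x Ux; apply: continuous_comp; [exact: cf|exact: cL].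
have dL y : differentiable L y by exact: linear_differentiable.
move=> [df Df]; split=> [x Ux|v].
  by apply: differentiable_comp => //; exact: df.
apply: Ck_eq_near (IH _ (Df v)) => x; apply: near_open => // y Uy.
have dfy := df y Uy.
rewrite [RHS]deriveE; last exact: differentiable_comp.
by rewrite diff_comp//= diff_lin// deriveE.
Qed.

(** The directional derivatives of [x |-> f (a + L x)] are
    those of [f] along [L v], as difference quotients, at every point. *)
Lemma Ck_preaffine E E' F k (U : set E') (f : E' -> F) (a : E')
    (L : {linear E -> E'}) : continuous L ->
  Ck k U f -> Ck k ((fun x => a + L x) @^-1` U) (fun x => f (a + L x)).
Proof.
move=> cL.
have dA x : is_diff x (fun x => a + L x) L.
  have dL : is_diff x L L.
    by apply: DiffDef; [exact: linear_differentiable|exact: diff_lin].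
  by have := is_diffD (is_diff_cst a x) dL; rewrite add0r.
elim: k U f => [|k IH] U f.
  move=> cf x Ux.
  apply: (@continuous_comp _ _ _ (fun x => a + L x) f); last exact: cf.
  exact/differentiable_continuous/ex_diff.
move=> [df Df].
have dc x : U (a + L x) -> differentiable (f \o (fun x => a + L x)) x.
  by move=> Ux; apply: differentiable_comp; [exact: ex_diff|exact: df].
split=> [x Ux|v]; first exact: dc.
rewrite (_ : (fun x => _) = (fun x => 'D_(L v) f (a + L x))).
  exact: IH (Df (L v)).
apply/funext => x; rewrite /derive.
rewrite (_ : (fun h : R => _) = (fun h : R =>
  h^-1 *: ((f \o shift (a + L x)) (h *: L v) - f (a + L x))))//.
by apply/funext => t /=; rewrite linearP addrCA.
Qed.

(** The derivative of [g \o f] along [v] is the sum over [i] of the [i]-th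
    coordinate of ['D_v f] times [('D_(e_i) g) \o f]. Expanding in the basis of
    row vectors turns the varying direction ['D_v f x] into finitely many fixed
    ones, to which the induction hypothesis applies. *)
Lemma Ck_comp n E F k (U : set E) (V : set 'rV[R]_n) (f : E -> 'rV[R]_n)
    (g : 'rV[R]_n -> F) :
  open U -> open V -> (forall x, U x -> V (f x)) ->
  Ck k U f -> Ck k V g -> Ck k U (g \o f).
Proof.
move=> oU oV UV; elim: k g f UV => [|k IH] g f UV Cf Cg.
  by move=> x Ux; apply: continuous_comp; [exact: Cf|exact/Cg/UV].
have [df Df] := Cf; have [dg Dg] := Cg; split=> [x Ux|v].
  by apply: differentiable_comp; [exact: df|exact/dg/UV].
pose h i := fun x => ('D_v f x) 0 i *: 'D_(delta_mx 0 i) g (f x).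
apply: (@Ck_eq_near _ _ _ _ (\sum_(i < n) h i)).
  move=> x; apply: near_open => // y Uy.
  have dfy := df y Uy; have dgy := dg _ (UV y Uy).
  rewrite [RHS]deriveE; last exact: differentiable_comp.
  rewrite diff_comp//= [X in _ = 'd g (f y) X]row_sum_delta linear_sum fct_sumE.
  by apply: eq_bigr => i _; rewrite /h linearZ/= !deriveE.
apply: Ck_sum => // i; apply: Ck_scale => //.
  have cl : linear (fun N : 'rV[R]_n => N 0 i : R^o).
    by move=> a u w; rewrite !mxE.
  pose LM := GRing.isLinear.Build _ _ _ _ _ cl.
  pose L : {linear 'rV[R]_n -> R^o} :=
    HB.pack (fun N : 'rV[R]_n => N 0 i : R^o) LM.
  have cL : continuous L by move=> w; exact: coord_continuous.
  exact: (Ck_postlin oU cL (Df v)).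
exact: (IH ('D_(delta_mx 0 i) g) f UV (CkW Cf) (Dg _)).
Qed.

End Ck.

(** * Linear maps and lines in finite dimension *)

Section FiniteDim.
Variable R : realType.
Implicit Types E F : normedModType R.

Lemma bounded_continuous E F (L : {linear E -> F}) (C : R) :
  (forall x, `|L x| <= C * `|x|) -> continuous L.
Proof.
move=> H; apply: bounded_linear_continuous; apply/linear_boundedP.
exists C; split; first exact: num_real.
by move=> r Cr x; apply: le_trans (H x) _; rewrite ler_wpM2r// ltW.
Qed.

Lemma rV_linear_continuous n F (L : {linear 'rV[R]_n -> F}) : continuous L.
Proof.
apply: (@bounded_continuous _ _ L (\sum_i `|L (delta_mx 0 i)|)) => x.
rewrite [X in L X]row_sum_delta linear_sum mulr_suml.
apply: le_trans (ler_norm_sum _ _ _) _; apply: ler_sum => i _.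
rewrite linearZ/= normrZ mulrC ler_wpM2l//.
rewrite [leRHS]mx_normrE.
exact: (le_bigmax _ (fun ij => `|x ij.1 ij.2|) (0, i)).
Qed.

Lemma fd_linear_continuous (V : vectType R) F (L : {linear fdspace V -> F}) :
  continuous L.
Proof.
(* [v2r] is an isometry onto row vectors by definition of the norm. *)
have [C HC] : exists C, forall x : fdspace V, `|L x| <= C * `|x|.
  have ll : linear (fun v => L (r2v v : fdspace V)).
    by move=> a u v; rewrite [X in L X](linearP (@r2v _ V)) [LHS]linearP.
  pose LM := GRing.isLinear.Build _ _ _ _ _ ll.
  pose L' : {linear 'rV[R]_(dim V) -> F} :=
    HB.pack (fun v => L (r2v v : fdspace V)) LM.
  have [k _ Hk] := linear_lipschitz (rV_linear_continuous (L := L')).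
  by exists k => x; have := Hk (v2r x); rewrite /= v2rK.
exact: bounded_continuous HC.
Qed.

Lemma is_diff_hom n (m : 'Hom('rV[R]_n, R^o)) (F : 'rV[R]_n -> 'rV[R]_n) x :
  differentiable F x ->
  differentiable (fun z => m (F z) : R^o) x /\
  forall w, 'd (fun z => m (F z) : R^o) x w = m ('d F x w).
Proof.
move=> dF; pose L : {linear 'rV[R]_n -> R^o} := m.
have cL : continuous L by exact: rV_linear_continuous.
have dL : differentiable L (F x) by exact: linear_differentiable.
split; first exact: (differentiable_comp dF dL).
move=> w; apply: (etrans (congr1 (@^~ w) (diff_comp dF dL))).
exact: (congr1 (@^~ _) (@diff_lin R _ _ L _ cL)).
Qed.

Lemma is_derive_line E F (f : E -> F) (a w : E) :
  differentiable f a ->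
  is_derive (0 : R) 1 (fun s : R => f (a + s *: w)) ('d f a w).
Proof.
move=> df.
have E1 : (fun h : R => f (h *: w + a)) = (fun s => f (a + s *: w)).
  by apply/funext => s; rewrite addrC.
apply: DeriveDef.
  by have /derivable1P := diff_derivable (v := w) df; rewrite E1.
rewrite -deriveE// /derive.
rewrite (_ : (fun h : R => h^-1 *: _) =
  (fun h : R => h^-1 *: ((f \o shift a) (h *: w) - f a)))//.
by apply/funext => s /=; rewrite addr0 scale0r addr0 [_%:A]mulr1 (addrC a).
Qed.

Lemma is_derive_line0 E F (f : E -> F) w :
  differentiable f 0 ->
  is_derive (0 : R) 1 (fun s : R => f (s *: w)) ('d f 0 w).
Proof.
move=> df; have := is_derive_line w df.
rewrite (_ : (fun s : R => f (0 + s *: w)) = (fun s => f (s *: w)))//.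
by apply/funext => s; rewrite add0r.
Qed.

Lemma is_derive_line0N E F (f : E -> F) w :
  differentiable f 0 ->
  is_derive (0 : R) 1 (fun s : R => f (- (s *: w))) (- 'd f 0 w).
Proof.
move=> df; have := is_derive_line0 (- w) df; rewrite linearN.
rewrite (_ : (fun s : R => f (s *: - w)) = (fun s => f (- (s *: w))))//.
by apply/funext => s; rewrite scalerN.
Qed.

Lemma is_derive_scale (a : R^o) : is_derive (0 : R) 1 (fun s : R => s *: a) a.
Proof.
have d : is_diff (0 : R) ( *:%R ^~ a) ( *:%R ^~ a) := is_diff_scalel 0 a.
apply: DeriveDef; first exact/diff_derivable/ex_diff.
by rewrite deriveE ?diff_val ?scale1r//; exact: ex_diff.
Qed.

Lemma is_derive_fsum N (T : 'I_N -> R -> R^o) (d : 'I_N -> R^o) :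
  (forall j, is_derive (0 : R) 1 (T j) (d j)) ->
  is_derive (0 : R) 1 (fun s => \sum_(j < N) T j s) (\sum_(j < N) d j).
Proof.
move=> DT; have -> : (fun s => \sum_(j < N) T j s) = \sum_(j < N) T j.
  by apply/funext => s; rewrite fct_sumE.
exact: is_derive_sum.
Qed.

End FiniteDim.

Lemma linfunE (R : nzRingType) (aT rT : vectType R) (f : aT -> rT) :
  linear f -> linfun f =1 f.
Proof.
move=> fl; pose fM := GRing.isLinear.Build _ _ _ _ _ fl.
exact: (lfunE (HB.pack f fM : {linear aT -> rT})).
Qed.

Lemma bidual_evalE (R : realType) (X : vectType R) (x : X) (a : 'Hom(X, R^o)) :
  bidual_eval X x a = a x.
Proof.
pose f (x : X) := fun a : 'Hom(X, R^o) => a x : R^o.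
have fl y : linear (f y) by move=> c u v; rewrite /f add_lfunE scale_lfunE.
have gl : linear (fun y => linfun (f y)).
  move=> c u v; apply/lfunP => b.
  by rewrite add_lfunE scale_lfunE !(linfunE (fl _)) /f linearP.
exact: etrans (congr1 (fun h : 'Hom(_, _) => h a) (linfunE gl x))
  (linfunE (fl x) a).
Qed.

(** Evaluation embeds [X] into its bidual, and the dimensions agree. *)
Lemma bidual_evalK (R : realType) (X : vectType R)
    (phi : 'Hom('Hom(X, R^o), R^o)) (a : 'Hom(X, R^o)) :
  a ((bidual_eval X)^-1%VF phi) = phi a.
Proof.
(* Coordinate functionals separate points. *)
have k0 : lker (bidual_eval X) == 0%VS.
  apply/lker0P => x y xy; apply: (can_inj v2rK); apply/rowP => i.
  have cl : linear (fun z : X => v2r z 0 i : R^o).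
    by move=> c u v; rewrite linearP !mxE.
  have := congr1 (fun h : 'Hom(_, _) =>
    h (linfun (fun z : X => v2r z 0 i : R^o))) xy.
  by rewrite (bidual_evalE x) (bidual_evalE y) !(linfunE cl) => ->.
have lf : limg (bidual_eval X) = fullv.
  apply/eqP; rewrite eqEdim subvf/= limg_dim_eq; last by rewrite (eqP k0) capv0.
  rewrite !dimvf; have : (dim X * 1 * 1 <= dim X)%N by rewrite !muln1.
  exact.
have E : bidual_eval X ((bidual_eval X)^-1%VF phi) = phi.
  by apply: limg_lfunVK; rewrite lf memvf.
exact: etrans (esym (bidual_evalE _ _)) (congr1 (fun h : 'Hom(_, _) => h a) E).
Qed.

(** * Differentiable maps between manifolds *)

Section Charts.
Variable R : realType.
Implicit Types E F : normedModType R.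

(** Continuity is part of the notion because the chart expression alone does not
    see where [f] sends points outside the chart around [f x]. *)
Definition mdiff E F (M : charted E) (N : charted F) (f : M -> N) (x : M) :=
  {for x, continuous f} /\
  differentiable (in_charts f x (f x)) (chart_at x x).

Lemma chart_image_open E (M : charted E) (x : M) (B : set M) :
  open B -> open (chart_at x @` (cdom (chart_at x) `&` B)).
Proof.
move=> oB; set c := chart_at x.
rewrite openE => _ [y [dy By] <-]; rewrite /interior.
have ty := cto_tgt dy.
have cf : \forall v \near c y, B (cfrom c v).
  have := cfrom_cts ty; rewrite /prop_for /continuous_at (ctoK dy); apply.
  exact: open_nbhs_nbhs.
near=> v; have tv : ctgt c v.
  near: v; apply: open_nbhs_nbhs; split => //; exact: ctgt_open.
exists (cfrom c v); last exact: cfromK.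
by split; [exact: cfrom_dom|near: v].
Unshelve. all: by end_near. Qed.

Lemma near_chart E (M : charted E) (x y : M) (P : M -> Prop) :
  cdom (chart_at x) y -> (\near y, P y) ->
  \forall v \near chart_at x y, P (cfrom (chart_at x) v).
Proof.
move=> dy Py; have := cfrom_cts (cto_tgt dy).
by rewrite /prop_for /continuous_at (ctoK dy); apply.
Qed.

Lemma near_ctgt E (M : charted E) (x y : M) :
  cdom (chart_at x) y -> \forall v \near chart_at x y, ctgt (chart_at x) v.
Proof.
by move=> dy; apply: open_nbhs_nbhs; split; [exact: ctgt_open|exact: cto_tgt].
Qed.

Lemma near_cdom E (M : charted E) (x y : M) :
  cdom (chart_at x) y -> \near y, cdom (chart_at x) y.
Proof.
by move=> dy; apply: open_nbhs_nbhs; split => //; exact: cdom_open.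
Qed.

Lemma Ck_on_mdiff E F (M : charted E) (N : charted F) k (W : set M) f x :
  Ck_on M N k.+1 W f -> W x -> mdiff f x.
Proof.
move=> [cf Cf] Wx; split; first exact: cf.
case: (Cf x (f x)) => d _; apply: d.
by exists x => //; split; [split => //; exact: chart_at_dom|exact: chart_at_dom].
Qed.

(** Only near [x0], since [f] has to stay in the domain of the intermediate
    chart. *)
Lemma in_charts_comp E F H (M : charted E) (N : charted F) (P : charted H)
    (f : M -> N) (g : N -> P) (x : M) (y : N) (z : P) (x0 : M) :
  cdom (chart_at x) x0 -> cdom (chart_at y) (f x0) -> {for x0, continuous f} ->
  \forall v \near chart_at x x0,
    in_charts g y z (in_charts f x y v) = in_charts (g \o f) x z v.
Proof.
move=> dx dy cf.
have : \forall v \near chart_at x x0,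
    cdom (chart_at y) (f (cfrom (chart_at x) v)).
  apply: (near_chart (P := fun t => cdom (chart_at y) (f t))) => //.
  by apply: cf; exact: near_cdom.
by apply: filterS => v dv; rewrite /in_charts (ctoK dv).
Qed.

Lemma in_chartsE E F (M : charted E) (N : charted F) (f : M -> N) x y :
  in_charts f x y (chart_at x x) = chart_at y (f x).
Proof. by rewrite /in_charts ctoK//; exact: chart_at_dom. Qed.

Lemma mdiff_comp E F H (M : charted E) (N : charted F) (P : charted H)
    (f : M -> N) (g : N -> P) (x : M) :
  mdiff f x -> mdiff g (f x) ->
  mdiff (g \o f) x /\
  tmap M P (g \o f) x = tmap N P g (f x) \o tmap M N f x :> (E -> H).
Proof.
move=> [cf df] [cg dg].
have nE := @in_charts_comp _ _ _ M N P f g x (f x) (g (f x)) x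
  (chart_at_dom x) (chart_at_dom (f x)) cf.
have fx := in_chartsE f x (f x).
rewrite -fx in dg.
have dgf := differentiable_comp df dg.
have [d dE] := near_eq_is_diff nE dgf.
split; first by split => //; exact: continuous_comp.
by rewrite /tmap dE -[in RHS]fx -diff_comp.
Qed.

Lemma tmap_near E F (M : charted E) (N : charted F) (f g : M -> N) (x : M) :
  (\near x, f x = g x) -> mdiff f x ->
  mdiff g x /\ tmap M N g x = tmap M N f x :> (E -> F).
Proof.
move=> fg [cf df].
have fgx : f x = g x by exact: nbhs_singleton fg.
have nE : \forall v \near chart_at x x,
    in_charts f x (f x) v = in_charts g x (g x) v.
  have := near_chart (chart_at_dom x) fg.
  by apply: filterS => v; rewrite /in_charts fgx => ->.
have [d dE] := near_eq_is_diff nE df.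
split=> //; split => //; move: cf; rewrite /prop_for /continuous_at -fgx.
by apply: cvg_trans; exact: near_eq_cvg.
Qed.

Lemma tmap_id E (M : charted E) (x : M) :
  mdiff (idfun : M -> M) x /\ tmap M M idfun x = id :> (E -> E).
Proof.
have nE : \forall v \near chart_at x x, id v = in_charts (idfun : M -> M) x x v.
  apply: filterS (near_ctgt (chart_at_dom x)) => v tv.
  by rewrite /in_charts cfromK.
have d0 : is_diff (chart_at x x) (id : E -> E) id by exact: is_diff_id.
have [d dE] := near_eq_is_diff nE ex_diff.
split; first by split => //; exact: cvg_id.
by rewrite /tmap dE diff_val.
Qed.

Lemma mdiff_cst E F (M : charted E) (N : charted F) (b : N) (x : M) :
  mdiff (cst b : M -> N) x.
Proof.
split; first exact: cst_continuous.
exact: (@differentiable_cst R E F (chart_at b b)).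
Qed.

Lemma mdiff_pair E F H (M : charted E) (N : charted F) (P : charted H)
    (f : M -> N) (g : M -> P) (x : M) :
  mdiff f x -> mdiff g x -> mdiff (N := cprod N P) (fun y => (f y, g y)) x.
Proof.
move=> [cf df] [cg dg]; split; first exact: cvg_pair.
exact: differentiable_pair.
Qed.

Lemma smooth_comp n E F (M : charted E) (N : charted 'rV[R]_n) (P : charted F)
    (f : M -> N) (g : N -> P) :
  smooth M N f -> smooth N P g -> smooth M P (g \o f).
Proof.
move=> sf sg k.
have cf x : {for x, continuous f} by case: (sf 0%N) => c _; exact: c.
have cg x : {for x, continuous g} by case: (sg 0%N) => c _; exact: c.
have oi (M1 M2 : topologicalType) (h : M1 -> M2) B :
  (forall x, {for x, continuous h}) -> open B -> open (h @^-1` B).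
  by move=> ch; move: B; apply/continuousP.
split=> [x _|x z]; first exact: continuous_comp.
(* Each clause of [Ck] quantifies over single points of the set, so it is
   enough to treat a point at a time; the chart of [N] used in the middle may
   then depend on that point. *)
suff loc x0 : cdom (chart_at x) x0 -> cdom (chart_at z) (g (f x0)) ->
    Ck k [set chart_at x x0] (in_charts (g \o f) x z).
  elim: k (in_charts _ _ _) loc => [|k IH] h loc.
    by move=> _ [x0 [[dx _] dz] <-]; exact: (loc x0 dx dz _ erefl).
  split=> [_ [x0 [[dx _] dz] <-]|v].
    by case: (loc x0 dx dz) => d _; exact: (d _ erefl).
  by apply: IH => x0 dx dz; case: (loc x0 dx dz) => _ D; exact: D.
move=> dx dz; pose y := f x0.
pose U := chart_at x @` (cdom (chart_at x) `&`
  (f @^-1` (cdom (chart_at y) `&` g @^-1` cdom (chart_at z)))).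
pose V := chart_at y @` (cdom (chart_at y) `&` (g @^-1` cdom (chart_at z))).
have ogz : open (g @^-1` cdom (chart_at z)).
  by apply: oi => //; exact: cdom_open.
have oV : open V by exact: chart_image_open.
have oU : open U.
  apply: chart_image_open; apply: oi => //; apply: openI => //; exact: cdom_open.
have Ux0 : U (chart_at x x0).
  by exists x0 => //; split => //; split => //; exact: chart_at_dom.
have UV v : U v -> V (in_charts f x y v).
  move=> [t [dt [dft dgt]] <-]; exists (f t) => //.
  by rewrite /in_charts ctoK.
have Cf : Ck k U (in_charts f x y).
  apply: Ck_subset (proj2 (sf k) x y) => _ [t [dt [dft dgt]] <-].
  by exists t.
have Cg : Ck k V (in_charts g y z).
  apply: Ck_subset (proj2 (sg k) y z) => _ [t [dt dgt] <-].
  by exists t.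
apply: (Ck_eq_near (f := in_charts g y z \o in_charts f x y)).
  by move=> _ ->; apply: in_charts_comp => //; exact: chart_at_dom.
by apply: Ck_subset (Ck_comp oU oV UV Cf Cg) => _ ->.
Qed.

Lemma smooth_line E (a w : E) :
  smooth (vec R^o) (vec E) (fun s => a + s *: w).
Proof.
have ll : linear (fun s : R^o => s *: w).
  by move=> c u v; rewrite scalerDl scalerA.
pose LM := GRing.isLinear.Build _ _ _ _ _ ll.
pose L : {linear R^o -> E} := HB.pack (fun s : R^o => s *: w) LM.
have cL : continuous L by exact: scalel_continuous.
move=> k; split=> [s _|s y].
  by apply: continuousD; [exact: cst_continuous|exact: cL].
have H : Ck k ((fun x => a + L x) @^-1` setT) (fun s => id (a + L s)).
  apply: (@Ck_preaffine _ R^o E E k setT id a L cL).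
  by apply: (@Ck_linear R E E k setT idfun) => x; exact: cvg_id.
by apply: Ck_subset H => ? _.
Qed.

Lemma smooth_cst E F (M : charted E) (N : charted F) (b : N) :
  smooth M N (cst b : M -> N).
Proof.
move=> k; split=> [s _|s y]; first exact: cst_continuous.
exact: (@Ck_cst R E F k _ (chart_at y b)).
Qed.

End Charts.

(** * Translations in a Lie group *)

Section LieGroup.
Variables (R : realType) (n : nat) (G : lieGroup R n).
Local Notation g := 'rV[R]_n.

Lemma smooth_mul :
  smooth (cprod (man G) (man G)) (man G) (fun p => p.1 * p.2)%g.
Proof. by case: (lieP G). Qed.

Lemma mdiff_mul p :
  mdiff (M := cprod (man G) (man G)) (N := man G) (fun p => p.1 * p.2)%g p.
Proof. exact: (Ck_on_mdiff (smooth_mul 1%N) I). Qed.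

Lemma mdiff_rmul (b x : G) : mdiff (M := man G) (N := man G) (fun y => y * b)%g x.
Proof.
have dp : mdiff (M := man G) (N := cprod (man G) (man G)) (fun y => (y, b)) x.
  apply: mdiff_pair; first by case: (tmap_id (x : man G)).
  exact: mdiff_cst.
by case: (mdiff_comp dp (mdiff_mul _)).
Qed.

(** In charts, left translation is the multiplication composed with an affine
    inclusion of one factor. *)
Lemma smooth_lmul (a : G) : smooth (man G) (man G) (fun x => a * x)%g.
Proof.
move=> k; have [cm Cm] := smooth_mul k.
split=> [x _|x y].
  apply: (@continuous_comp _ _ _ (fun x => (a, x) : G * G)
    (fun p => p.1 * p.2)%g).
    by apply: cvg_pair; [exact: cvg_cst|exact: cvg_id].
  exact: cm.
have il : linear (fun v : g => (0, v) : g * g).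
  by move=> c u v; congr pair; rewrite /= scaler0 addr0.
pose iM := GRing.isLinear.Build _ _ _ _ _ il.
pose i : {linear g -> (g * g)%type} := HB.pack (fun v : g => (0, v) : g * g) iM.
have ci : continuous i.
  apply: (@bounded_continuous _ _ _ i 1) => v.
  by rewrite mul1r /i/= ge_max normr0 normr_ge0 lexx.
pose aa : (g * g)%type := (chart_at (a : man G) a, 0).
have iE v : aa + i v = (chart_at (a : man G) a, v).
  by rewrite /aa /i/=; congr pair; rewrite /= ?addr0 ?add0r.
have caa : cdom (chart_at (a : man G)) a by exact: chart_at_dom.
have -> : in_charts (M := man G) (N := man G) (fun x => a * x)%g x y =
    (fun v => in_charts (M := cprod (man G) (man G)) (N := man G)
      (fun p => p.1 * p.2)%g (a, x) y (aa + i v)).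
  by apply/funext => v; rewrite iE /in_charts/= ctoK.
apply: Ck_subset (Ck_preaffine aa ci (Cm (a, x) y)) => _ [t [[dt _] dat] <-].
by rewrite /preimage/= iE; exists (a, t).
Qed.

(** Right translation by [b^-1] is an inverse. *)
Lemma tmap_rmul_lker (b : G) :
  lker (linfun (tmap (man G) (man G) (fun x => x * b)%g 1%g)) == 0%VS.
Proof.
pose r (c : G) : man G -> man G := fun x => (x * c)%g.
apply/lker0P => v w; rewrite !lfunE/= => vw.
have [d dE] := mdiff_comp (mdiff_rmul b 1%g) (mdiff_rmul b^-1%g _).
have [_ idE] := tmap_id (1%g : man G).
have [e eE] : mdiff (M := man G) (N := man G) idfun 1%g /\
    tmap (man G) (man G) idfun 1%g =
    tmap (man G) (man G) (r b^-1%g \o r b) 1%g :> (g -> g).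
  by apply: tmap_near d; apply: nearW => x /=; rewrite mulgK.
have H u : u = tmap (man G) (man G) (r b^-1%g) (1 * b)%g
    (tmap (man G) (man G) (r b) 1%g u).
  exact: (etrans (esym (congr1 (@^~ u) idE))
    (etrans (congr1 (@^~ u) eE) (congr1 (@^~ u) dE))).
exact: (etrans (H v) (etrans (congr1 _ vw) (esym (H w)))).
Qed.

Lemma smooth_curve (tau : g -> G) (a : G) (w : g) :
  smooth (vec g) (man G) tau ->
  smooth (vec R^o) (man G) (fun s => a * tau (s *: w))%g.
Proof.
move=> st; have := smooth_comp (smooth_line 0 w) (smooth_comp st (smooth_lmul a)).
rewrite (_ : (_ \o _) \o _ = (fun s => a * tau (s *: w))%g)//.
by apply/funext => s /=; rewrite add0r.
Qed.

Lemma differentiable_slice (E : normedModType R) (W : G * E -> R) (a : E) :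
  C1 (cprod (man G) (vec E)) (vec R^o) W ->
  differentiable (fun v => W (1%g, v) : R^o) a.
Proof.
move=> CW; have d1 : mdiff (M := vec E) (N := cprod (man G) (vec E))
    (fun v => (1%g, v)) a.
  by apply: mdiff_pair; [exact: mdiff_cst|case: (tmap_id (a : vec E))].
by case: (mdiff_comp d1 (Ck_on_mdiff CW I)) => -[].
Qed.

End LieGroup.

(** * Retraction maps *)

Section Retraction.
Variables (R : realType) (n : nat) (G : lieGroup R n).
Local Notation g := 'rV[R]_n.
Variables (tau : g -> G) (U : set g) (tauinv : G -> g).
Hypothesis htau : is_retraction tau U tauinv.

Lemma retractionN xi : tau (- xi) = (tau xi)^-1%g.
Proof.
case: htau => _ _ _ _ tN.
by rewrite -[LHS]mul1g -(mulVg (tau xi)) -mulgA tN mulg1.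
Qed.

Let tau0 : tau 0 = 1%g. Proof. by case: htau. Qed.

Lemma mdiff_tau z : mdiff (M := vec g) (N := man G) tau z.
Proof. by case: htau => st *; exact: (Ck_on_mdiff (st 1%N) I). Qed.

Lemma mdiff_tauinv z : U z -> mdiff (M := man G) (N := vec g) tauinv (tau z).
Proof.
case: htau => _ _ [_ st] _ _ Uz.
by apply: (Ck_on_mdiff (st 1%N)); exists z.
Qed.

Lemma tmap_tauinv_tau xi : U xi ->
  cancel (tmap (vec g) (man G) tau xi)
         (tmap (man G) (vec g) tauinv (tau xi)).
Proof.
move=> Uxi; have [_ [oU _ _] [tK _] _ _] := htau.
have [d dE] := mdiff_comp (mdiff_tau xi) (mdiff_tauinv Uxi).
have nE : \forall z \near (xi : vec g), (tauinv \o tau) z = idfun z.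
  by apply: (near_open oU _ Uxi) => z; exact: tK.
have [_ e] := tmap_near (M := vec g) (N := vec g) (g := idfun) nE d.
move=> v; have [_ i] := tmap_id (xi : vec g).
exact: (etrans (esym (congr1 (@^~ v) dE))
  (etrans (esym (congr1 (@^~ v) e)) (congr1 (@^~ v) i))).
Qed.

Lemma tmap_tau_tauinv xi : U xi ->
  cancel (tmap (man G) (vec g) tauinv (tau xi))
         (tmap (vec g) (man G) tau xi).
Proof.
move=> Uxi; have [_ [oU _ otU] [tK _] _ _] := htau.
have := mdiff_comp (mdiff_tauinv Uxi) (mdiff_tau _).
rewrite (tK _ Uxi) => -[d dE].
have nE : \forall z \near (tau xi : man G), (tau \o tauinv) z = idfun z.
  have : (tau @` U) (tau xi) by exists xi.
  move=> tU; apply: filterS (open_nbhs_nbhs (conj otU tU)) => _ [z Uz <-] /=.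
  by rewrite tK.
have [_ e] := tmap_near (M := man G) (N := man G) (g := idfun) nE d.
move=> v; have [_ i] := tmap_id (tau xi : man G).
exact: (etrans (esym (congr1 (@^~ v) dE))
  (etrans (esym (congr1 (@^~ v) e)) (congr1 (@^~ v) i))).
Qed.

Lemma lker_lfunV (V : vectType R) (f : 'End(V)) :
  lker f == 0%VS -> lker f^-1 == 0%VS.
Proof.
move=> kf; apply/lker0P => u v uv.
by rewrite -(lker0_lfunVK kf u) uv lker0_lfunVK.
Qed.

Lemma lfun_divE (V : vectType R) (A B : 'End(V)) u v :
  lker A == 0%VS -> B u = A v -> (A^-1 \o B)%VF u = v.
Proof. by move=> kA BA; rewrite comp_lfunE BA lker0_lfunK. Qed.

Lemma lker_dtau xi : U xi -> lker (dtau tau xi) == 0%VS.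
Proof.
move=> Uxi; apply/lker0P => u v; rewrite /dtau !comp_lfunE.
move/(lker0P (lker_lfunV (tmap_rmul_lker (tau xi)))); rewrite !lfunE/=.
exact: (can_inj (tmap_tauinv_tau Uxi)).
Qed.

(** Right multiplication by [tau xi], read in the coordinates [tau]. Both
    occurrences of [tauinv] in the action become this map, up to signs, along
    the variations of a group element. *)
Definition tau_mul (xi z : g) : g := tauinv (tau z * tau xi)%g.

(** This is where [dtau] enters. The chain rule gives the differential at 0 as
    the inverse of [T_xi tau] after the differential of right translation by
    [tau xi] after [T_0 tau], and the first two factors make up the inverse of
    the right trivialized tangent. *)
Lemma is_diff_tau_mul xi : U xi ->
  differentiable (tau_mul xi) 0 /\
  forall w, 'd (tau_mul xi) 0 w =
    ((dtau tau xi)^-1)%VF (tmap (vec g) (man G) tau 0 w).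
Proof.
move=> Uxi.
have [d1 e1] := mdiff_comp (mdiff_tau 0) (mdiff_rmul (tau xi) _).
have mt : mdiff (M := man G) (N := vec g) tauinv
    (((fun x => x * tau xi)%g \o tau) 0).
  by rewrite /= tau0 mul1g; exact: mdiff_tauinv.
have [d2 e2] := mdiff_comp d1 mt.
split; first by case: d2.
have key B0 : tmap (man G) (vec g) tauinv (tau xi)
      (tmap (man G) (man G) (fun x => x * tau xi)%g 1%g B0)
    = ((dtau tau xi)^-1)%VF B0.
  have inj : injective (dtau tau xi) by exact/lker0P/lker_dtau.
  apply: inj; rewrite lker0_lfunVK; last exact: lker_dtau.
  pose A := linfun (tmap (man G) (man G) (fun x => x * tau xi)%g 1%g).
  pose B := linfun (tmap (vec g) (man G) tau xi).
  have BA : B (tmap (man G) (vec g) tauinv (tau xi)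
    (tmap (man G) (man G) (fun x => x * tau xi)%g 1%g B0)) = A B0.
    exact: (etrans (lfunE _ _)
      (etrans (tmap_tau_tauinv Uxi _) (esym (lfunE _ _)))).
  exact: (lfun_divE (tmap_rmul_lker _) BA).
move=> w; apply: etrans (key _).
move: e1 e2; rewrite /= tau0 mul1g => e1 e2.
exact: (etrans (congr1 (@^~ w) e2)
  (congr1 (tmap (man G) (vec g) tauinv (tau xi)) (congr1 (@^~ w) e1))).
Qed.

(** Inversion in [G] is negation in the coordinates [tau]; this reduces left
    multiplication by [tau xi] to right multiplication by [tau (- xi)], and
    accounts for the minus sign in the covector of the previous step. *)
Lemma near_tau_mulN xi : U xi -> U (- xi) ->
  \forall z \near (0 : g), tauinv (tau xi * tau z)%g = - tau_mul (- xi) (- z).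
Proof.
move=> Uxi UNxi; have [_ [oU _ otU] [tK _] _ _] := htau.
have [d _] := is_diff_tau_mul UNxi.
have cN : (- z) @[z --> (0 : g)] --> (0 : g).
  by rewrite -[X in _ --> X]oppr0; exact: opp_continuous.
have F0 : tau_mul (- xi) 0 = - xi by rewrite /tau_mul tau0 mul1g tK.
have c1 : tau_mul (- xi) (- z) @[z --> (0 : g)] --> - xi.
  rewrite -[X in _ --> X]F0; apply: (cvg_comp _ _ cN).
  exact: differentiable_continuous.
have n1 : \forall z \near (0 : g), U (- tau_mul (- xi) (- z)).
  have := cvgN c1; rewrite opprK; apply; exact: open_nbhs_nbhs.
have c2 : (tau (- z) * tau (- xi))%g @[z --> (0 : g)] --> tau (- xi).
  have [d1 _] := mdiff_comp (mdiff_tau 0) (mdiff_rmul (tau (- xi)) _).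
  have := d1.1; rewrite /prop_for /continuous_at /= tau0 mul1g => c.
  exact: (cvg_comp _ _ cN c).
have n2 : \forall z \near (0 : g), (tau @` U) (tau (- z) * tau (- xi))%g.
  by apply: c2; apply: open_nbhs_nbhs; split => //; exists (- xi).
(* Near 0, [tau (- z) * tau (- xi)] is [tau y] with [y] and [- y] in [U], and
   its inverse is [tau (- y)]. *)
apply: filterS2 n1 n2 => z; rewrite /tau_mul => Uz [y Uy yE].
rewrite -yE tK// in Uz *; rewrite -(tK _ Uz); congr tauinv.
by rewrite retractionN yE !retractionN -invgM invgK.
Qed.

End Retraction.

(** * The extended potential *)

Section Potential.
Variables (R : realType) (n : nat) (G : lieGroup R n) (X : vectType R).
Local Notation g := 'rV[R]_n.
Variables (Vext : G * fdspace 'Hom(X, R^o) -> R).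
Hypothesis hVext_reg :
  C1 (cprod (man G) (vec (fdspace 'Hom(X, R^o)))) (vec R^o) Vext.
Variable rho : G -> 'End(X).
Hypothesis hrho : is_representation rho.
Hypothesis hVext_inv : forall (a b : G) (alpha : 'Hom(X, R^o)),
       Vext ((a * b)%g, rho_adj rho a^-1%g alpha) = Vext (b, alpha).

Lemma rho_adjM a b alpha :
  rho_adj rho (a * b)%g alpha = rho_adj rho b (rho_adj rho a alpha).
Proof. by case: hrho => _ rM _; rewrite /rho_adj rM comp_lfunA. Qed.

Lemma rho_adj1 alpha : rho_adj rho 1%g alpha = alpha.
Proof. by case: hrho => r1 _ _; rewrite /rho_adj r1 comp_lfun1r. Qed.

(** Invariance moves the dependence on the group element into the parameter. *)
Lemma Vext_reduce a alpha : Vext (a, alpha) = Vext (1%g, rho_adj rho a alpha).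
Proof.
have := hVext_inv a 1%g (rho_adj rho a alpha).
by rewrite mulg1 -rho_adjM mulgV rho_adj1.
Qed.

Lemma momentum_mapE x (alpha : 'Hom(X, R^o)) eta :
  momentum_map rho x alpha eta = alpha (rho' rho eta x).
Proof.
have fl : linear (fun xi : g => alpha (rho' rho xi x) : R^o).
  move=> c u v.
  have -> : rho' rho (c *: u + v) = c *: rho' rho u + rho' rho v.
    exact: linearP.
  by rewrite add_lfunE scale_lfunE linearP.
exact: (linfunE fl).
Qed.

Variable alpha : 'Hom(X, R^o).

Let V1 (a : fdspace 'Hom(X, R^o)) : R^o := Vext (1%g, a).

Let post (A : fdspace 'End(X)) : fdspace 'Hom(X, R^o) := (alpha \o A)%VF.

Let post_linear : linear post.
Proof. by move=> c u v; rewrite /post comp_lfunDr comp_lfunZr. Qed.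

Let postM := GRing.isLinear.Build _ _ _ _ _ post_linear.
Let postL : {linear fdspace 'End(X) -> fdspace 'Hom(X, R^o)} :=
  HB.pack post postM.

Lemma dVextE (b : 'Hom(X, R^o)) :
  b (dVext Vext alpha) = 'd V1 (alpha : fdspace 'Hom(X, R^o)) b.
Proof. by rewrite /dVext bidual_evalK; exact: lfunE. Qed.

(** Here [V] is [a |-> Vext (1, a)] after the linear map [A |-> alpha \o A] after
    [rho \o tau]. Its differential pairs [alpha \o rho' eta] with [dVext], which
    is the momentum map at [eta]. *)
Lemma is_diff_potential (tau : g -> G) :
  mdiff (M := vec g) (N := man G) tau 0 -> tau 0 = 1%g ->
  let V z := Vext (1%g, rho_adj rho (tau z) alpha) : R^o in
  differentiable V 0 /\
  forall w, 'd V 0 w =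
    momentum_map rho (dVext Vext alpha) alpha (tmap (vec g) (man G) tau 0 w).
Proof.
move=> dt t0 V.
have dr : mdiff (M := man G) (N := vec (fdspace 'End(X))) rho (tau 0).
  by case: hrho => _ _ sr; exact: (Ck_on_mdiff (sr 1%N) I).
have [d1 e1] := mdiff_comp dt dr.
have dp : mdiff (M := vec (fdspace 'End(X))) (N := vec (fdspace 'Hom(X, R^o)))
    post (rho (tau 0)).
  split; first exact: (fd_linear_continuous (L := postL)).
  exact: (linear_differentiable (f := postL) _
    (fd_linear_continuous (L := postL))).
have [d2 e2] := mdiff_comp d1 dp.
have dV1 a : mdiff (M := vec (fdspace 'Hom(X, R^o))) (N := vec R^o) V1 a.
  have dV := differentiable_slice a hVext_reg.
  by split=> //; exact: differentiable_continuous.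
have [d3 e3] := mdiff_comp d2 (dV1 _).
split; first by case: d3.
move=> w; rewrite momentum_mapE.
have ep : tmap (vec (fdspace 'End(X))) (vec (fdspace 'Hom(X, R^o))) post
    (rho (tau 0)) = post :> (fdspace 'End(X) -> fdspace 'Hom(X, R^o)).
  exact: (@diff_lin R _ _ postL _ (fd_linear_continuous (L := postL))).
have pt : post (rho (tau 0)) = alpha.
  by case: hrho => r1 _ _; rewrite /post t0 r1; exact: comp_lfun1r.
have key (A : 'End(X)) : alpha (A (dVext Vext alpha)) =
    'd V1 (alpha : fdspace 'Hom(X, R^o)) (post A).
  by rewrite -dVextE comp_lfunE.
apply: etrans (esym (key _)).
have q : tmap (vec g) (vec (fdspace 'Hom(X, R^o))) (post \o (rho \o tau)) 0 w
    = post (rho' rho (tmap (vec g) (man G) tau 0 w)).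
  apply: (etrans (congr1 (@^~ w) e2)); apply: (etrans (congr1 (@^~ _) ep)).
  apply: (congr1 post); apply: (etrans (congr1 (@^~ w) e1)).
  exact: (congr1 (fun p => tmap (man G) (vec (fdspace 'End(X))) rho p _) t0).
apply: (etrans (congr1 (@^~ w) e3)).
apply: (etrans (congr1 (tmap (vec _) (vec R^o) V1 _) q)).
exact: (congr1
  (fun p => tmap (vec (fdspace 'Hom(X, R^o))) (vec R^o) V1 p _) pt).
Qed.

End Potential.

(** * Stationarity of the augmented action *)

Section Extremal.
Variables (R : realType) (n m : nat) (G : lieGroup R n).
Local Notation g := 'rV[R]_n.
Variables (e : n.-tuple g) (e0 : g) (h : R) (hh : 0 < h).
Variables (tau : g -> G) (U : set g) (tauinv : G -> g).
Hypothesis htau : is_retraction tau U tauinv.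
Variable Cd : G * fdspace (subvs_of (kspace m e)) -> R.
Hypothesis hCd_reg : C1 (cprod (man G) (vec (fdspace (subvs_of (kspace m e)))))
                  (vec R^o) Cd.
Hypothesis hCd_inv : forall (a b : G) v, Cd ((a * b)%g, v) = Cd (b, v).
Variables (X : vectType R) (alpha0 : 'Hom(X, R^o)).
Variables (Vext : G * fdspace 'Hom(X, R^o) -> R).
Hypothesis hVext_reg :
  C1 (cprod (man G) (vec (fdspace 'Hom(X, R^o)))) (vec R^o) Vext.
Variable rho : G -> 'End(X).
Hypothesis hrho : is_representation rho.
Hypothesis hVext_inv : forall (a b : G) (alpha : 'Hom(X, R^o)),
       Vext ((a * b)%g, rho_adj rho a^-1%g alpha) = Vext (b, alpha).
Variables (N : nat) (gi gf : G).
Variables (gs : nat -> G) (us : nat -> g) (mus : nat -> 'Hom(g, R^o)).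
Hypothesis hus : forall k, (k < N)%N -> U (h *: us k) /\ U (- (h *: us k)).
Hypothesis hex :
  normal_extremal e0 h tau tauinv Cd Vext alpha0 N gi gf gs us mus.

Let L := aug_lagrangian e0 h tauinv Cd Vext alpha0.
Let tau0 : tau 0 = 1%g. Proof. by case: htau. Qed.
Let st : smooth (vec g) (man G) tau. Proof. by case: htau. Qed.

Let CdE a v : Cd (a, v) = Cd (1%g, v).
Proof. by rewrite -{1}[a]mulg1 hCd_inv. Qed.

(* With the invariances, the two group arguments enter only through the advected
   parameter and the discrete velocity. *)
Let LE a b u (mu : 'Hom(g, R^o)) : L a b u mu =
  Cd (1%g, kpart m e e0 u) + Vext (1%g, rho_adj rho a alpha0)
  + (mu (tauinv (a^-1 * b)%g) - h * mu (u - e0)).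
Proof.
rewrite /L /aug_lagrangian CdE (Vext_reduce hrho hVext_inv); congr (_ + _).
rewrite linearB linearZ/= mulrBr; congr (_ - _).
by rewrite -[_ *: _]/(_ * _) mulrA divff ?mul1r// gt_eqF.
Qed.

Let J k := momentum_map rho (dVext Vext (rho_adj rho (gs k) alpha0))
  (rho_adj rho (gs k) alpha0).
Let T0 := tmap (vec g) (man G) tau 0.

(** Since [(gs k * tau (s *: w))^-1 * gs k.+1] is
    [tau (- (s *: w)) * tau (h *: us k)], the discrete velocity is [tau_mul]
    along the line of direction [- w]. *)
Lemma is_derive_first_slot k w : (k < N)%N ->
  is_derive (0 : R) 1
    (fun s : R => L (gs k * tau (s *: w))%g (gs k.+1) (us k) (mus k))
    (J k (T0 w) - mus k ((dtau tau (h *: us k))^-1%VF (T0 w))).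
Proof.
move=> kN; have [Uk _] := hus kN; have [_ _ gsS _] := hex.
have [dV eV] := is_diff_potential hVext_reg hrho
  (rho_adj rho (gs k) alpha0) (mdiff_tau htau 0) tau0.
have [dF eF] := is_diff_tau_mul htau Uk.
have [dM eM] := is_diff_hom (mus k) dF.
rewrite /J -eV -eF -eM.
have D1 := is_derive_line0 w dV; have D2 := is_derive_line0N w dM.
pose c : R^o := Cd (1%g, kpart m e e0 (us k)) - h * mus k (us k - e0).
have D3 := is_deriveD (is_derive_cst c (0 : R) 1) (is_deriveD D1 D2).
rewrite add0r in D3; move: D3; congr (is_derive _ _ _ _).
apply/funext => s; rewrite LE (rho_adjM hrho) /= gsS//.
rewrite (_ : ((gs k * tau (s *: w))^-1 * (gs k * tau (h *: us k)))%g =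
  (tau (- (s *: w)) * tau (h *: us k))%g); last first.
  by rewrite (retractionN htau) invgM -mulgA mulKg.
by rewrite -[LHS]/(c + (_ + _)) /c addrACA; congr (_ + _); exact: addrC.
Qed.

(** Here the discrete velocity is [tauinv (tau (h *: us k) * tau (s *: w))], to
    which [near_tau_mulN] applies. *)
Lemma is_derive_second_slot k w : (k.+1 < N)%N ->
  is_derive (0 : R) 1
    (fun s : R => L (gs k) (gs k.+1 * tau (s *: w))%g (us k) (mus k))
    (mus k ((dtau tau (- (h *: us k)))^-1%VF (T0 w))).
Proof.
move=> kN; have kN' := ltnW kN; have [Uk UNk] := hus kN'.
have [_ _ gsS _] := hex.
have [dF eF] := is_diff_tau_mul htau UNk.
have [dM eM] := is_diff_hom (mus k) dF.
rewrite -eF -eM.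
have D2 := is_deriveN (is_derive_line0N w dM); rewrite opprK in D2.
pose c : R^o := Cd (1%g, kpart m e e0 (us k))
  + Vext (1%g, rho_adj rho (gs k) alpha0) - h * mus k (us k - e0).
have D3 := is_deriveD (is_derive_cst c (0 : R) 1) D2; rewrite add0r in D3.
apply: near_eq_is_derive D3.
have sw : s *: w @[s --> (0 : R)] --> (0 : g).
  have c0 : continuous ( *:%R ^~ w : R -> g).
    exact: (@scalel_continuous R (g : normedModType R) w).
  have := c0 0; rewrite /continuous_at scale0r; exact.
have near_eq : \forall s \near (0 : R),
    tauinv (tau (h *: us k) * tau (s *: w))%g =
    - tau_mul tau tauinv (- (h *: us k)) (- (s *: w)).
  exact: sw (near_tau_mulN htau Uk UNk).
apply: filterS near_eq => s sE.
rewrite LE gsS// mulgA mulgA mulVg mul1g sE linearN /=.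
by rewrite -[LHS]/(c + - _) /c -[LHS]addrA; congr (_ + _); exact: addrC.
Qed.

(** Moving only the group element of index [k] along [gs k * tau (s *: w)]
    affects the two summands of index [k] and [k.-1]. *)
Lemma stationary_group k w : (1 <= k < N)%N ->
  J k (T0 w) - mus k ((dtau tau (h *: us k))^-1%VF (T0 w))
  + mus k.-1 ((dtau tau (- (h *: us k.-1)))^-1%VF (T0 w)) = 0.
Proof.
case/andP; case: k => [//|k] _ kN /=; have [[g0 gN] usk gsS ex] := hex.
pose gv j (s : R) := if j == k.+1 then (gs k.+1 * tau (s *: w))%g else gs j.
pose uv j (s : R) := us j.
have var : is_variation m e e0 N gs us gv uv.
  split.
  - move=> j _; rewrite /gv; case: eqP => [->|_].
      by split; [exact: smooth_curve | rewrite scale0r tau0 mulg1].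
    by split=> //; exact: smooth_cst.
  - by move=> s; rewrite /gv/= (gtn_eqF kN).
  - move=> j jN; split=> //; last by move=> s; exact: usk.
    exact: (@smooth_cst R R^o g (vec R^o) (vec g) (us j)).
have D0 := ex gv uv var.
pose T (j : 'I_N) (s : R) : R^o := L (gv j s) (gv j.+1 s) (uv j s) (mus j).
pose d (j : 'I_N) : R^o :=
  if j == k.+1 :> nat then
    J k.+1 (T0 w) - mus k.+1 ((dtau tau (h *: us k.+1))^-1%VF (T0 w))
  else if j == k :> nat then mus k ((dtau tau (- (h *: us k)))^-1%VF (T0 w))
  else 0.
have DT j : is_derive (0 : R) 1 (T j) (d j).
  rewrite /T /gv /d /uv eqSS; case: (eqVneq (j : nat) k.+1) => [->|jk1].
    by rewrite (gtn_eqF (ltnSn _)); exact: is_derive_first_slot.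
  case: (eqVneq (j : nat) k) => [->|jk]; first exact: is_derive_second_slot.
  exact: is_derive_cst.
have D1 := is_derive_fsum DT.
have := @derive_val _ _ _ _ _ _ _ D1; rewrite (@derive_val _ _ _ _ _ _ _ D0).
have kN' := ltnW kN.
rewrite (bigD1 (Ordinal kN))// (bigD1 (Ordinal kN'))/=; last first.
  by rewrite -val_eqE/= (ltn_eqF (ltnSn _)).
rewrite big1 => [|j]; last first.
  by rewrite -!val_eqE/= /d => /andP[/negPf-> /negPf->].
by rewrite /d/= eqxx (ltn_eqF (ltnSn _)) eqxx addr0 => ->.
Qed.

Lemma stationary_control k d : (k < N)%N -> d \in kspace m e ->
  'd (fun v : fdspace (subvs_of (kspace m e)) => Cd (1%g, v) : R^o)
    (kpart m e e0 (us k)) (vsproj (kspace m e) d) = h * mus k d.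
Proof.
move=> kN dk; have [_ usk _ ex] := hex.
pose gv j (s : R) := gs j.
pose uv j (s : R) := if j == k then us k + s *: d else us j.
have var : is_variation m e e0 N gs us gv uv.
  split=> //.
    by move=> j _; split=> //; exact: smooth_cst.
  move=> j jN; rewrite /uv; case: eqP => [->|_].
    split; first exact: smooth_line.
      by rewrite scale0r addr0.
    by move=> s; rewrite addrAC rpredD ?usk// rpredZ.
  split=> //; last by move=> s; exact: usk.
  exact: (@smooth_cst R R^o g (vec R^o) (vec g) (us j)).
have D0 := ex gv uv var.
set V1 := fun v : fdspace _ => _.
have dV1 : differentiable V1 (kpart m e e0 (us k)).
  exact: (differentiable_slice _ hCd_reg).
pose T (j : 'I_N) (s : R) : R^o := L (gv j s) (gv j.+1 s) (uv j s) (mus j).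
pose D : R^o :=
  'd V1 (kpart m e e0 (us k)) (vsproj (kspace m e) d) - h * mus k d.
have DT j : is_derive (0 : R) 1 (T j) (if j == k :> nat then D else 0).
  rewrite /T /gv /uv; case: (eqVneq (j : nat) k) => [->|jk]; last first.
    exact: is_derive_cst.
  pose c : R^o := Vext (1%g, rho_adj rho (gs k) alpha0)
    + mus k (tauinv ((gs k)^-1 * gs k.+1)%g) - h * mus k (us k - e0).
  have D1 := is_derive_line (vsproj (kspace m e) d : fdspace _) dV1.
  have D2 := is_deriveD (is_derive_cst c (0 : R) 1)
    (is_deriveN (is_derive_scale (h * mus k d))).
  rewrite add0r in D2.
  have := is_deriveD D1 D2; congr (is_derive _ _ _ _).
  apply/funext => s; rewrite LE.
  have -> : kpart m e e0 (us k + s *: d) =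
      kpart m e e0 (us k) + s *: (vsproj (kspace m e) d : fdspace _).
    by rewrite /kpart addrAC linearD linearZ.
  have -> : mus k (us k + s *: d - e0) = mus k (us k - e0) + s * mus k d.
    by rewrite addrAC linearD linearZ.
  rewrite mulrDr (mulrCA h s).
  by rewrite -[LHS]/(V1 _ + (c - s * (h * mus k d))) /c /V1 opprD !addrA.
have D1 := is_derive_fsum DT.
have := @derive_val _ _ _ _ _ _ _ D1; rewrite (@derive_val _ _ _ _ _ _ _ D0).
rewrite (bigD1 (Ordinal kN))//= eqxx big1 => [|j]; last first.
  by rewrite -!val_eqE/= => /negPf->.
by rewrite addr0 => /esym/eqP; rewrite subr_eq0 => /eqP.
Qed.

Lemma momentum_recursion k : (1 <= k < N)%N ->
  dtauinv_adj tau (h *: us k) (mus k)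
  = dtauinv_adj tau (- (h *: us k.-1)) (mus k.-1) + J k.
Proof.
move=> kN; apply/lfunP => eta.
have U0 : U 0 by case: htau => _ [].
(* Every [eta] is the velocity of one of the curves [s |-> tau (s *: w)]. *)
have surj : T0 (tmap (man G) (vec g) tauinv (tau 0) eta) = eta.
  exact: (tmap_tau_tauinv htau U0).
have := stationary_group (tmap (man G) (vec g) tauinv (tau 0) eta) kN.
rewrite surj => E1.
apply: (etrans (comp_lfunE _ _ _)); apply/esym.
apply: (etrans (add_lfunE _ _ _)).
apply: (etrans (congr1 (fun x => x + J k eta) (comp_lfunE _ _ _))).
by apply/eqP; rewrite -subr_eq0 -addrA addrC; apply/eqP.
Qed.

Lemma dCdE u v : dCd e0 Cd u v =
  'd (fun v : fdspace (subvs_of (kspace m e)) => Cd (1%g, v) : R^o)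
    (kpart m e e0 u) (vsproj (kspace m e) (daddv_pi (kspace m e) (pspace m e) v)).
Proof.
by rewrite /dCd !comp_lfunE; apply: (etrans (lfunE _ _)); rewrite lfunE.
Qed.

Lemma kstar_part_mu k : (k < N)%N ->
  kstar_part m e (mus k) = h^-1 *: dCd e0 Cd (us k).
Proof.
move=> kN; apply/lfunP => v; rewrite scale_lfunE dCdE /kstar_part comp_lfunE.
rewrite stationary_control//; last exact: memv_pi.
by rewrite -[RHS]/(_ * _) mulKf// gt_eqF.
Qed.

End Extremal.

Lemma kstar_part_id (R : realType) (n m : nat) (e : n.-tuple 'rV[R]_n)
    (mu : 'Hom('rV[R]_n, R^o)) : basis_of fullv e ->
  (forall v, v \in pspace m e -> mu v = 0) -> kstar_part m e mu = mu.
Proof.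
move=> /andP[/eqP sp fe] mu0; apply/lfunP => v; rewrite /kstar_part comp_lfunE.
move: fe sp; rewrite -{1 2}(cat_take_drop m e) cat_free span_cat.
move=> /and3P[_ _ /directv_addP dir] sp.
have vkp : v \in (kspace m e + pspace m e)%VS.
  by rewrite /kspace /pspace sp memvf.
have <- : mu (daddv_pi (kspace m e) (pspace m e) v
    + daddv_pi (pspace m e) (kspace m e) v) = mu v.
  exact: congr1 (daddv_pi_add dir vkp).
by rewrite linearD [X in _ = _ + X]mu0 ?addr0//; exact: memv_pi.
Qed.

Theorem theorem2 (R : realType) (n m : nat) (hm : (1 <= m <= n)%N)
    (G : lieGroup R n)
    (e : n.-tuple 'rV[R]_n) (he : basis_of fullv e)
    (e0 : 'rV[R]_n) (he0 : e0 \in pspace m e)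
    (h : R) (hh : 0 < h)
    (tau : 'rV[R]_n -> G) (U : set 'rV[R]_n) (tauinv : G -> 'rV[R]_n)
    (htau : is_retraction tau U tauinv)
    (Cd : G * fdspace (subvs_of (kspace m e)) -> R)
    (hCd_reg : C1 (cprod (man G) (vec (fdspace (subvs_of (kspace m e)))))
                  (vec R^o) Cd)
    (hCd_inv : forall (a b : G) v, Cd ((a * b)%g, v) = Cd (b, v))
    (Vd : G -> R)
    (hVd_reg : C1 (man G) (vec R^o) Vd)
    (hVd_not_inv : ~ (forall a b : G, Vd (a * b)%g = Vd b))
    (X : vectType R) (alpha0 : 'Hom(X, R^o))
    (Vext : G * fdspace 'Hom(X, R^o) -> R)
    (hVext_reg : C1 (cprod (man G) (vec (fdspace 'Hom(X, R^o)))) (vec R^o) Vext)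
    (hVext : forall a : G, Vext (a, alpha0) = Vd a)
    (rho : G -> 'End(X)) (hrho : is_representation rho)
    (hVext_inv : forall (a b : G) (alpha : 'Hom(X, R^o)),
       Vext ((a * b)%g, rho_adj rho a^-1%g alpha) = Vext (b, alpha))
    (hVd_inv : forall a : G, rho_adj rho a alpha0 = alpha0 ->
       forall b : G, Vd (a * b)%g = Vd b)
    (N : nat) (gi gf : G)
    (gs : nat -> G) (us : nat -> 'rV[R]_n) (mus : nat -> 'Hom('rV[R]_n, R^o))
    (hus : forall k, (k < N)%N -> U (h *: us k) /\ U (- (h *: us k)))
    (hextremal : normal_extremal e0 h tau tauinv Cd Vext alpha0 N gi gf
                   gs us mus) :
  let alphas k := rho_adj rho (gs k) alpha0 in
  [/\ forall k, (1 <= k < N)%N ->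
        dtauinv_adj tau (h *: us k) (mus k)
        = dtauinv_adj tau (- (h *: us k.-1)) (mus k.-1)
          + momentum_map rho (dVext Vext (alphas k)) (alphas k),
      forall k, (k < N)%N ->
        alphas k.+1 = rho_adj rho (tau (h *: us k)) (alphas k),
      alphas 0%N = rho_adj rho gi alpha0 &
      forall k, (k < N)%N ->
        kstar_part m e (mus k) = h^-1 *: dCd e0 Cd (us k)
        /\ ((forall v, v \in pspace m e -> mus k v = 0) ->
            mus k = h^-1 *: dCd e0 Cd (us k))].
Proof.
move=> alphas; have [[g0 _] _ gsS _] := hextremal.
split=> [k kN|k kN||k kN].
- exact: (momentum_recursion hh htau hCd_inv hVext_reg hrho hVext_inv hus
    hextremal).
- by rewrite /alphas gsS//; exact: rho_adjM.
- by rewrite /alphas g0.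
- have kE := kstar_part_mu hh hCd_reg hCd_inv hrho hVext_inv hextremal kN.
  by split=> // /(kstar_part_id he) <-.
Qed.
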